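(* Consider the APLC testing problem described in the context. If $r>\rho(\beta;\sigma)$, then the Berk–Jones statistic $M_n$ is asymptotically powerful (as a test rejecting $H_0$ for small values of $M_n$): there exist thresholds $h_n$ such that $$\Pr_{H_0}(M_n<h_n)+\Pr_{H_1^{(n)}}(M_n\ge h_n)\to 0\quad (n\to\infty).$$
   Context: For $\mu\in\mathbb R$ and $\sigma>0$, $\chi^2(\mu,\sigma)$ denotes the law of $(\mu+\sigma Z)^2$ with $Z\sim\mathcal N(0,1)$; $\chi^2_2$ denotes the chi-squared law with two degrees of freedom (density $\tfrac12 e^{-u/2}$ on $u>0$). APLC testing problem: for each $n$ one observes independent random variables $p_1,\dots,p_n\in(0,1)$. Under $H_0$, $p_1,\dots,p_n$ are i.i.d. $\mathrm{Unif}(0,1)$, i.e. $-2\log p_i\sim\chi^2_2$. Under $H_1^{(n)}$, the $p_i$ are independent with $-2\log p_i\sim(1-\epsilon_n)\chi^2_2+\epsilon_n Q_i^{(n)}$, $i=1,\dots,n$, where $\epsilon_n=n^{-\beta}$, $\mu_n=\sqrt{2r\log n}$, $\beta\in(0,1)$, $r>0$, $\sigma>0$ are fixed (independent of $n$), and each $Q_i^{(n)}$ is a probability distribution on $(0,\infty)$ with a density satisfying the APLC condition: for every $q>0$, $$\lim_{n\to\infty}\frac{1}{\log n}\max_{1\le i\le n}\left|\log\frac{dQ_i^{(n)}}{d\chi^2(\mu_n,\sigma)}(q\log n)\right|=0,$$ where $\frac{dQ_i^{(n)}}{d\chi^2(\mu_n,\sigma)}$ is the ratio of the densities. The function $\rho(\beta;\sigma)$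 is defined for $\beta\in(1/2,1)$ by: if $0<\sigma^2<2$, $\rho(\beta;\sigma)=(2-\sigma^2)(\beta-1/2)$ for $1/2<\beta<1-\sigma^2/4$ and $\rho(\beta;\sigma)=(1-\sigma\sqrt{1-\beta})^2$ for $1-\sigma^2/4\le\beta<1$; if $\sigma^2\ge 2$, $\rho(\beta;\sigma)=0$ for $1/2<\beta<1-1/\sigma^2$ and $\rho(\beta;\sigma)=(1-\sigma\sqrt{1-\beta})^2$ for $1-1/\sigma^2\le\beta<1$. Berk–Jones statistic: with $p_{(1)}\le\dots\le p_{(n)}$ the order statistics, let $\pi_i=\Pr(\mathrm{Beta}(i,n-i+1)<p_{(i)})$ (probability over an independent Beta variable, conditional on the data), and $M_n=\min\{M_n^-,M_n^+\}$ with $M_n^-=\min_i\pi_i$, $M_n^+=\min_i(1-\pi_i)$. *)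

(* Defs.v *)
From HB Require Import structures.
From mathcomp Require Import all_boot all_order all_algebra.
From mathcomp Require Import all_classical all_reals all_analysis.
Set Implicit Arguments.
Unset Strict Implicit.
Unset Printing Implicit Defensive.
Import Order.TTheory GRing.Theory Num.Theory Num.Def.
Import numFieldNormedType.Exports.
Local Open Scope classical_set_scope.
Local Open Scope ring_scope.

Section aplc.
Context {R : realType}.

Definition mutually_independent d (T : measurableType d) (P : probability T R)
    (n : nat) (X : 'I_n -> T -> R) : Prop :=
  forall A : 'I_n -> set R, (forall i, measurable (A i)) ->
    P (\bigcap_(i in [set: 'I_n]) (X i @^-1` A i)) =
    (\prod_(i < n) P (X i @^-1` A i))%E.

(* density of chi^2(mu, sigma) = law of (mu + sigma Z)^2 at u > 0:
   (phi_{mu,sigma}(sqrt u) + phi_{mu,sigma}(- sqrt u)) / (2 sqrt u),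
   phi_{mu,sigma} the N(mu, sigma^2) density (library normal_pdf). *)
Definition chi2nc_pdf (mu sigma u : R) : R :=
  (normal_pdf mu sigma (Num.sqrt u) + normal_pdf mu sigma (- Num.sqrt u))
    / (2 * Num.sqrt u).

Definition chi2_2_pdf (u : R) : R := expR (- u / 2) / 2.

Definition law_of_density (f : R -> R) (A : set R) : \bar R :=
  (\int[lebesgue_measure]_(u in A `&` `]0%R, +oo[) (f u)%:E)%E.

Definition eps_n (beta : R) (n : nat) : R := (n%:R) `^ (- beta).
Definition mu_n (r : R) (n : nat) : R := Num.sqrt (2 * r * ln (n%:R)).

Definition rho (beta sigma : R) : R :=
  if sigma ^+ 2 < 2 then
    (if beta < 1 - sigma ^+ 2 / 4 then (2 - sigma ^+ 2) * (beta - 2^-1)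
     else (1 - sigma * Num.sqrt (1 - beta)) ^+ 2)
  else
    (if beta < 1 - (sigma ^+ 2)^-1 then 0
     else (1 - sigma * Num.sqrt (1 - beta)) ^+ 2).

(* APLC condition for the densities g n i of Q_i^(n), i = 0..n-1
   (index i stands for the paper's i+1).  The positivity clause makes
   explicit that the logarithms in the paper are eventually finite. *)
Definition APLC (r sigma : R) (g : forall n : nat, 'I_n -> R -> R) : Prop :=
  forall q : R, 0 < q ->
    (\forall n \near \oo, forall i : 'I_n, 0 < g n i (q * ln (n%:R))) /\
    ((fun n : nat => (ln (n%:R))^-1 *
        \big[maxr/0]_(i < n)
          `| ln (g n i (q * ln (n%:R)) /
                 chi2nc_pdf (mu_n r n) sigma (q * ln (n%:R))) |)
       @ \oo --> (0 : R)).

Definition order_stats (n : nat) (x : 'I_n -> R) : seq R :=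
  sort <=%R [seq x i | i <- enum 'I_n].

(* pi_i = Pr(Beta(i, n-i+1) < p_(i)); for i : 'I_n this is the paper's pi_{i+1} *)
Definition BJ_pi (n : nat) (x : 'I_n -> R) (i : 'I_n) : R :=
  fine (beta_prob i.+1 (n - i) `]-oo, nth 0 (order_stats x) i[).

Definition BJ_Mminus (n : nat) (x : 'I_n -> R) : R :=
  \big[minr/1]_(i < n) BJ_pi x i.
Definition BJ_Mplus (n : nat) (x : 'I_n -> R) : R :=
  \big[minr/1]_(i < n) (1 - BJ_pi x i).
Definition BJ_M (n : nat) (x : 'I_n -> R) : R := minr (BJ_Mminus x) (BJ_Mplus x).

End aplc.

(* Main.v *)
Require Import Defs.
From HB Require Import structures.
From mathcomp Require Import all_boot all_order all_algebra.
From mathcomp Require Import all_classical all_reals all_analysis.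
From mathcomp Require Import measurable_realfun zify ring lra.
Import Order.TTheory GRing.Theory Num.Theory Num.Def.
Import numFieldNormedType.Exports.
Local Open Scope classical_set_scope.
Local Open Scope ring_scope.

(** The Beta probability P(Beta(i, n-i+1) < t) equals P(Bin(n, t) >= i), so under
H0 each pi_i is uniform and a union bound gives P(M_n < h) <= 2 n h; the
threshold h = n^-2 is therefore safe.

Under H1 fix 0 < q < 1 and count the p_i below t = n^-q.  The null part
contributes about m = n^(1-q), and the contamination contributes at least
n^(1 - beta - (sqrt w - sqrt r)^2 / sigma^2 - o(1)) for any w > q.  When
r > rho(beta, sigma) one can choose q and w so that the excess is at least
2 D with D of order n^((1-q)/2 + k), k > 0.  By Chernoff the count is then at
least m + D up to a probability exp(- c n^(2k)), and on that event, again by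
Chernoff, the corresponding pi_i is at most exp(- c n^(2k)) < h.

The APLC condition is only pointwise in q, while the tail mass of Q_i is an
integral: continuity of Lebesgue measure along the increasing sets of points
where the density bound has become valid gives the bound on half of a window,
uniformly in i. *)

Set Implicit Arguments.
Unset Strict Implicit.
Unset Printing Implicit Defensive.

(** * Binomial tails and Beta probabilities *)

Section binomial_tail.
Context {R : realType}.
Implicit Types (n k : nat) (t : R).

(** The probability that Bin(n, t) equals k, as a polynomial in t, so that differentiation in t is
    formal. *)
Definition binom_term n k : {poly R} := ('X^k * (1 - 'X) ^+ (n - k)) *+ 'C(n, k).

Definition binom_tail n k : {poly R} :=
  \sum_(j < n.+1 | (k <= j)%N) binom_term n j.

Lemma binom_tail_recl n k : (k <= n)%N ->
  binom_tail n k = binom_term n k + binom_tail n k.+1.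
Proof.
move=> kn; rewrite /binom_tail.
rewrite (bigD1 (Ordinal (kn : k < n.+1)%N))//=; congr (_ + _).
apply: eq_bigl => j; rewrite [RHS]ltn_neqAle andbC; congr (_ && _).
by rewrite -val_eqE/= eq_sym.
Qed.

Lemma binom_tail_gt n k : (n < k)%N -> binom_tail n k = 0.
Proof.
move=> nk; rewrite /binom_tail big_pred0// => j.
by apply/negbTE; rewrite -ltnNge (leq_trans (ltn_ord j)).
Qed.

(** The sum telescopes: the negative part of the derivative of each term cancels the positive part
    of the next, hence the induction on the distance [n - k.+1]. What is left is an unnormalised
    Beta(k+1, n-k) density. *)
Lemma deriv_binom_tail n k : (k < n)%N ->
  (binom_tail n k.+1)^`() =
  ('X^k * (1 - 'X) ^+ (n - k.+1)) *+ (k.+1 * 'C(n, k.+1)).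
Proof.
move=> kn; move: {2}(n - k.+1)%N (erefl (n - k.+1)%N) => d.
elim: d k kn => [|d IH] k kn nkd.
  have nk : n = k.+1 by apply/eqP; rewrite eqn_leq kn andbT -subn_eq0 nkd.
  rewrite binom_tail_recl// binom_tail_gt ?nk// addr0 /binom_term subnn expr0 mulr1.
  by rewrite binn mulr1n muln1 derivXn mulr1.
have kn1 : (k.+1 < n)%N by rewrite -subn_gt0 nkd.
rewrite binom_tail_recl// derivD IH//; last by rewrite subnS nkd.
rewrite /binom_term derivMn derivM derivXn deriv_exp derivB derivX derivC.
rewrite [(k.+2 * _)%N]mul_bin_left sub0r nkd subnS nkd/=.
rewrite mulN1r mulNrn mulrN mulrnBl.
by rewrite mulrnAl mulrnAr -!mulrnA subrK.
Qed.

Lemma binom_tail_horner0 n k : (binom_tail n k.+1).[0] = 0 :> R.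
Proof.
rewrite /binom_tail horner_sum big1// => j kj.
by rewrite hornerMn hornerM hornerXn expr0n gtn_eqF ?mul0r ?mul0rn ?(leq_trans _ kj).
Qed.

Lemma binom_tail_horner1 n k : (k <= n)%N -> (binom_tail n k).[1] = 1 :> R.
Proof.
move=> kn; rewrite /binom_tail horner_sum (bigD1 (@ord_max n))//= big1 ?addr0.
  by rewrite /binom_term subnn expr0 mulr1 binn mulr1n hornerXn expr1n.
move=> j /andP[kj jn]; rewrite hornerMn hornerM horner_exp !hornerE subrr.
rewrite expr0n subn_eq0 leqNgt ltn_neqAle -ltnS ltn_ord andbT.
by rewrite -val_eqE/= in jn; rewrite jn/= mulr0 mul0rn.
Qed.

End binomial_tail.

Section beta_binomial.
Context {R : realType}.
Implicit Types (n k : nat) (t : R).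

(** Both sides vanish at 0 and have the same derivative in [t]. *)
Lemma beta_prob_binom_tail n k t : (k < n)%N -> 0 <= t <= 1 ->
  beta_prob k.+1 (n - k) `]-oo, t[ = ((binom_tail n k.+1).[t])%:E.
Proof.
move=> kn /andP[t0 t1].
have -> : beta_prob k.+1 (n - k) `]-oo, t[ =
    (((beta_fun k.+1 (n - k))^-1)%:E *
     \int[lebesgue_measure]_(x in `[0%R, t]) (XMonemX k (n - k).-1 x)%:E)%E.
  rewrite /beta_prob /mscale/= integral_XMonemX_restrict//; congr (_ * _)%E.
  have -> : `]-oo, t[%classic `&` `[0%R, 1%R]%classic = `[0%R, t[%classic :> set R.
    apply/seteqP; split => x /=; rewrite !in_itv/=; lra.
  rewrite integral_itv_bndo_bndc//.
  by apply: measurableT_comp => //; exact: measurable_XMonemX.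
(* The fundamental theorem of calculus is applied on a nondegenerate interval, so t = 0 is treated
   apart. *)
have [->|tn0] := eqVneq t 0.
  by rewrite binom_tail_horner0 set_itv1 integral_set1 mule0.
rewrite (@continuous_FTC2 _ _
    (fun x => (beta_fun k.+1 (n - k)) * (binom_tail n k.+1).[x])).
- rewrite binom_tail_horner0 mulr0 sube0 -EFinM mulrA mulVf ?mul1r//.
  by rewrite gt_eqF// beta_fun_gt0.
- by rewrite lt_neqAle eq_sym tn0.
- exact: within_continuous_XMonemX.
- split => [x _||].
  + by apply: derivableM => //; exact: derivable_horner.
  + by apply: cvg_at_right_filter; apply: cvgM; [exact: cvg_cst|exact: continuous_horner].
  + by apply: cvg_at_left_filter; apply: cvgM; [exact: cvg_cst|exact: continuous_horner].
- move=> x _.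
  rewrite derive1Ml; last exact: derivable_horner.
  rewrite -derivE deriv_binom_tail// hornerMn hornerM hornerXn horner_exp !hornerE.
  rewrite /XMonemX -subnS -mulr_natl mulrA [X in X * _]mulrC.
  suff : (k.+1 * 'C(n, k.+1))%:R * beta_fun k.+1 (n - k) = 1 :> R.
    by move=> ->; rewrite mul1r.
  rewrite -[(n - k)%N]prednK ?subn_gt0// beta_fun_fact -subnS.
  rewrite -addnS -subSn// subSS subnKC ?(ltnW kn)//.
  rewrite mulrA -natrM.
  have -> : (k.+1 * 'C(n, k.+1) * (k`! * (n - k.+1)`!) = n`!)%N.
    by rewrite -(bin_fact kn) factS; lia.
  by rewrite divff// pnatr_eq0 -lt0n fact_gt0.
Qed.
End beta_binomial.

(** * Counts of independent events *)

Section subset_prob.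
Context {R : realType}.
Implicit Types (n k : nat) (s t v : R).

(** The probability that, among independent events of probabilities [a i], exactly those indexed by
    [J] occur. *)
Definition subset_prob n (a : 'I_n -> R) (J : {set 'I_n}) : R :=
  \prod_i (if i \in J then a i else 1 - a i).

Lemma subset_prob_ge0 n (a : 'I_n -> R) J :
  (forall i, 0 <= a i <= 1) -> 0 <= subset_prob a J.
Proof.
move=> a01; apply: prodr_ge0 => i _.
by have /andP[? ?] := a01 i; case: ifP; rewrite ?subr_ge0.
Qed.

(* Upper tails of [#|J|] correspond to [0 < s], lower tails to [s < 0]. *)
Lemma subset_prob_chernoff n (a : 'I_n -> R) (K : pred {set 'I_n}) s v :
  (forall i, 0 <= a i <= 1) ->
  (forall J, K J -> v <= s * #|J|%:R) ->
  \sum_(J | K J) subset_prob a J <= expR ((expR s - 1) * (\sum_i a i) - v).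
Proof.
move=> a01 Kv.
(* Markov's inequality: the indicator of [K] is at most exp(s #|J| - v). *)
apply: (@le_trans _ _ (\sum_J subset_prob a J * expR (s * #|J|%:R - v))).
  rewrite big_mkcond; apply: ler_sum => J _; case: ifPn => [KJ|_].
    rewrite ler_peMr ?subset_prob_ge0//.
    by rewrite (le_trans _ (expR_ge1Dx _))// lerDl subr_ge0 Kv.
  by rewrite mulr_ge0 ?subset_prob_ge0 ?expR_ge0.
under eq_bigr do rewrite expRD mulrA.
rewrite -mulr_suml expRD ler_wpM2r ?expR_ge0//.
(* Independence: the moment generating function of #|J| is a product over the indices. *)
have -> : \sum_J subset_prob a J * expR (s * #|J|%:R) =
    \prod_(i < n) (a i * expR s + (1 - a i)).
  rewrite bigA_distr; apply: eq_big => J; first by rewrite inE.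
  move=> _; rewrite mulrC -mulr_natr mulr_natr expRM_natr -prodr_const.
  rewrite /subset_prob [X in X * _ = _]big_mkcond -big_split/=.
  by apply: eq_bigr => i _; case: ifP => _; rewrite ?mul1r// mulrC.
rewrite mulr_sumr expR_sum; apply: ler_prod => i _.
have /andP[a0 a1] := a01 i; rewrite addr_ge0 ?mulr_ge0 ?expR_ge0 ?subr_ge0//=.
by rewrite (le_trans _ (expR_ge1Dx _))//; lra.
Qed.

(** Group the sets by cardinality: there are 'C(n, j) sets of size j, all of the same weight. *)
Lemma sum_subset_prob_binom_tail n k t :
  \sum_(J : {set 'I_n} | (k <= #|J|)%N) subset_prob (fun=> t) J =
  (binom_tail n k).[t].
Proof.
have card_lt (J : {set 'I_n}) : (#|J| < n.+1)%N.
  by rewrite ltnS -[leqRHS]card_ord max_card.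
rewrite (partition_big (fun J : {set 'I_n} => Ordinal (card_lt J))
  (fun j : 'I_n.+1 => (k <= j)%N))//=.
rewrite /binom_tail horner_sum; apply: eq_bigr => j kj.
rewrite /binom_term hornerMn hornerM hornerXn horner_exp !hornerE.
transitivity (\sum_(J : {set 'I_n} | #|J| == j) t ^+ j * (1 - t) ^+ (n - j)).
  apply: eq_big => J.
    rewrite -val_eqE/=; case: eqVneq => [->|]; last by rewrite andbF.
    by rewrite kj.
  move=> /andP[_]; rewrite -val_eqE/= => /eqP <-.
  rewrite /subset_prob (bigID (mem J))/=.
  congr (_ * _).
    rewrite (eq_bigr (fun=> t)) ?prodr_const// => i ->//.
  rewrite (eq_bigr (fun=> 1 - t)) => [|i /negbTE ->//].
  rewrite prodr_const; congr (_ ^+ _).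
  have := cardC (mem J); rewrite card_ord => /(canRL (addKn _)) <-.
  by apply: eq_card => i; rewrite !inE.
rewrite sumr_const; congr (_ *+ _).
have := card_draws 'I_n j; rewrite [#|'I_n|]card_ord cardsE => <-.
exact: eq_card.
Qed.
End subset_prob.

Section independent_counts.
Context {R : realType} d (T : measurableType d).
Implicit Types (n k : nat) (t : R).

Definition below n (X : 'I_n -> R) t : {set 'I_n} := finset (fun i => X i < t).

Lemma below_eqE n (X : 'I_n -> T -> R) t (J : {set 'I_n}) :
  [set w | below (X ^~ w) t == J] =
  \bigcap_(i in [set: 'I_n])
    X i @^-1` (if i \in J then `]-oo, t[%classic else `[t, +oo[%classic).
Proof.
apply/seteqP; split => w /=.
  move=> /eqP <- i _; rewrite inE.
  by case: ltP => H /=; rewrite in_itv/= ?andbT.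
move=> H; apply/eqP/setP => i; rewrite inE; have := H i I.
by case: (i \in J) => /=; rewrite in_itv/= ?andbT// leNgt => /negbTE.
Qed.

Lemma measurable_below_eq n (X : 'I_n -> T -> R) t (J : {set 'I_n}) :
  (forall i, measurable_fun setT (X i)) ->
  measurable [set w | below (X ^~ w) t == J].
Proof.
move=> mX; rewrite below_eqE; apply: fin_bigcap_measurable => // i _.
by rewrite -[X in measurable X]setTI; apply: mX => //; case: ifP.
Qed.

Lemma belowE n (X : 'I_n -> T -> R) t (K : pred {set 'I_n}) :
  [set w | K (below (X ^~ w) t)] =
  \bigcup_(J in [set J : {set 'I_n} | K J]) [set w | below (X ^~ w) t == J].
Proof.
apply/seteqP; split => w /=; first by move=> ?; exists (below (X ^~ w) t) => /=.
by move=> [J KJ /= /eqP ->].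
Qed.

Lemma measurable_below n (X : 'I_n -> T -> R) t (K : pred {set 'I_n}) :
  (forall i, measurable_fun setT (X i)) ->
  measurable [set w | K (below (X ^~ w) t)].
Proof.
move=> mX; rewrite belowE.
by apply: fin_bigcup_measurable => // J _; exact: measurable_below_eq.
Qed.

(** The event splits into the disjoint events where [below] is a given [J], and independence
    factorises each of them. The predicate [K] is arbitrary so as to cover both lower and upper
    tails of the count. *)
Lemma prob_below (P : probability T R) n (X : 'I_n -> T -> R) t
    (a : 'I_n -> R) (K : pred {set 'I_n}) :
  (forall i, measurable_fun setT (X i)) -> mutually_independent P X ->
  (forall i, P (X i @^-1` `]-oo, t[) = (a i)%:E) ->
  P [set w | K (below (X ^~ w) t)] = (\sum_(J | K J) subset_prob a J)%:E.
Proof.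
move=> mX indX Pa; rewrite belowE measure_fin_bigcup; last 3 first.
- exact: finite_finset.
- by move=> I J KI KJ [w [/= /eqP <- /eqP]].
- by move=> J _; exact: measurable_below_eq.
rewrite -sumEFin.
rewrite -[LHS](@bigfs _ _ _ _ (index_enum {set 'I_n})) ?index_enum_uniq//; last first.
  by move=> J _; rewrite mem_index_enum.
apply: eq_bigr => J _; rewrite below_eqE.
have /= -> := indX (fun i => if i \in J then `]-oo, t[%classic else `[t, +oo[%classic);
  last by move=> i; case: ifP.
rewrite /subset_prob -prodEFin; apply: eq_bigr => i _.
case: ifPn => _; first exact: Pa.
have -> : `[t, +oo[%classic = ~` `]-oo, t[%classic by rewrite setCitvl.
rewrite preimage_setC probability_setC ?Pa//.
by have := mX i measurableT _ (measurable_itv `]-oo, t[); rewrite setTI.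
Qed.

End independent_counts.

Lemma uniform_prob_below {R : realType} (t : R) : 0 <= t <= 1 ->
  uniform_prob (@ltr01 R) `]-oo, t[ = t%:E.
Proof.
move=> /andP[t0 t1]; rewrite /uniform_prob integral_uniform_pdf.
have -> : `]-oo, t[%classic `&` `[0, 1]%classic = `[0, t[%classic :> set R.
  by apply/seteqP; split => x /=; rewrite !in_itv/=; lra.
under eq_integral => x.
  rewrite inE/= in_itv/= => /andP[x0 xt].
  rewrite /uniform_pdf x0 (le_trans (ltW xt))//= subr0 invr1.
  over.
rewrite integral_cst//= mul1e.
rewrite lebesgue_measure_itv/= lte_fin.
by case: ltP => [|t0']; rewrite ?oppr0 ?adde0//; congr _%:E; lra.
Qed.

(** * Order statistics in terms of counts *)

Section order_statistics.
Context {R : realType}.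
Implicit Types (t : R).

(** In a sorted list the entries below [t] form a prefix. Positions start at 0, hence the strict
    comparison with the count. *)
Lemma sorted_nth_lt (s : seq R) (i : nat) t : sorted <=%R s -> (i < size s)%N ->
  (nth 0 s i < t) = (i < count (< t)%R s)%N.
Proof.
elim: s i => //= x s IH i xs; have ss := path_sorted xs.
have sx : all (>= x) s by apply: order_path_min xs; exact: le_trans.
have [xt|tx] := ltP x t.
  by case: i => [|i] si /=; rewrite ?xt ?add1n// ltnS -IH.
have -> : count (< t)%R s = 0%N.
  apply/eqP; rewrite -leqn0 leqNgt -has_count; apply/hasPn => y ys /=.
  by rewrite -leNgt (le_trans tx)// (allP sx).
rewrite ltn0 => si; apply/negbTE; rewrite -leNgt (le_trans tx)//.
case: i si => //= i si; exact/(allP sx)/mem_nth.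
Qed.

Lemma size_order_stats n (x : 'I_n -> R) : size (order_stats x) = n.
Proof. by rewrite size_sort size_map size_enum_ord. Qed.

Lemma nth_order_stats_lt n (x : 'I_n -> R) (i : 'I_n) t :
  (nth 0 (order_stats x) i < t) = (i < #|below x t|)%N.
Proof.
rewrite sorted_nth_lt ?size_order_stats//; last exact/sort_sorted/le_total.
rewrite (permP (permEl (perm_sort _ _))) count_map.
congr (_ < _)%N; rewrite -sum1_count -sum1_card big_enum_cond/=.
by apply: eq_bigl => j; rewrite inE.
Qed.

Lemma measurable_order_stats d (T : measurableType d) n (X : 'I_n -> T -> R)
    (i : 'I_n) : (forall i, measurable_fun setT (X i)) ->
  measurable_fun setT (fun w => nth 0 (order_stats (X ^~ w)) i).
Proof.
move=> mX; apply: (measurability _ (RGenInftyO.measurableE R)) => //.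
move=> _ [_ [t ->] <-]; rewrite setTI.
rewrite [X in measurable X](_ : _ = [set w | (i < #|below (X ^~ w) t|)%N]).
  exact: (measurable_below t (fun J => i < #|J|)%N mX).
by apply/seteqP; split => w /=; rewrite in_itv/= nth_order_stats_lt.
Qed.
End order_statistics.

(** * The Berk-Jones statistic under the null hypothesis *)

Section BJ_null.
Context {R : realType} d (T : measurableType d).
Implicit Types (n : nat) (h t : R).

(** [BJ_pi] is the Beta distribution function at an order statistic and the binomial tail is the
    same function at [t]; monotonicity compares the two arguments. It yields a strict conclusion
    here and a weak one in [BJ_pi_le]. *)
Lemma BJ_pi_lt n (x : 'I_n -> R) (i : 'I_n) t : 0 <= t <= 1 ->
  BJ_pi x i < (binom_tail n i.+1).[t] -> (i < #|below x t|)%N.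
Proof.
move=> t01; rewrite -nth_order_stats_lt; apply: contraTT; rewrite -!leNgt => tp.
rewrite -lee_fin -beta_prob_binom_tail// /BJ_pi fineK ?beta_prob_fin_num//.
by apply: le_measure; rewrite ?inE//; apply: subset_itvl; rewrite bnd_simp.
Qed.

Lemma BJ_pi_le n (x : 'I_n -> R) (i : 'I_n) t : 0 <= t <= 1 ->
  (i < #|below x t|)%N -> BJ_pi x i <= (binom_tail n i.+1).[t].
Proof.
move=> t01; rewrite -nth_order_stats_lt => pt.
rewrite -lee_fin -beta_prob_binom_tail// /BJ_pi fineK ?beta_prob_fin_num//.
by apply: le_measure; rewrite ?inE//; apply: subset_itvl; rewrite bnd_simp ltW.
Qed.

Lemma measurable_BJ_pi n (X : 'I_n -> T -> R) (i : 'I_n) :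
  (forall i, measurable_fun setT (X i)) ->
  measurable_fun setT (fun w => BJ_pi (X ^~ w) i).
Proof.
move=> mX.
pose F (u : R) : R := fine (beta_prob i.+1 (n - i) `]-oo, u[).
have mF : measurable_fun setT F.
  apply: nondecreasing_measurable => // u v uv.
  apply: fine_le; rewrite ?beta_prob_fin_num//.
  by apply: le_measure; rewrite ?inE//; apply: subset_itvl; rewrite bnd_simp.
exact: measurableT_comp mF (measurable_order_stats i mX).
Qed.

Lemma measurable_lt_cst (f : T -> R) h : measurable_fun setT f ->
  measurable [set w | f w < h].
Proof.
by move=> mf; have := mf measurableT _ (measurable_itv `]-oo, h[); rewrite setTI.
Qed.

Lemma measurable_bigmin n (f : 'I_n -> T -> R) (c : R) :
  (forall i, measurable_fun setT (f i)) ->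
  measurable_fun setT (fun w => \big[minr/c]_(i < n) f i w).
Proof.
move=> mf; elim: (index_enum _) => [|j s IH].
  by under eq_fun do rewrite big_nil; exact: measurable_cst.
under eq_fun do rewrite big_cons; exact: measurable_minr.
Qed.

Lemma measurable_BJ_M n (X : 'I_n -> T -> R) :
  (forall i, measurable_fun setT (X i)) ->
  measurable_fun setT (fun w => BJ_M (X ^~ w)).
Proof.
move=> mX; apply: measurable_minr; apply: measurable_bigmin => i.
  exact: measurable_BJ_pi.
by apply: measurable_funB => //; exact: measurable_BJ_pi.
Qed.

(** Intermediate values between 0 at t = 0 and 1 at t = 1. This supplies the Beta quantile of level
    [h], which turns events on [BJ_pi] into events on counts. *)
Lemma binom_tail_surj n k h : (k < n)%N -> 0 <= h <= 1 ->
  exists2 t, 0 <= t <= 1 & (binom_tail n k.+1).[t] = h.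
Proof.
move=> kn h01.
have [||t] := @IVT R (horner (binom_tail n k.+1)) 0 1 h ler01.
- exact/continuous_subspaceT/continuous_horner.
- rewrite binom_tail_horner0 binom_tail_horner1//.
  by rewrite min_l ?ler01// max_r ?ler01.
- by rewrite in_itv/= => t01 th; exists t.
Qed.

Section uniform_sample.
Variables (P : probability T R) (n : nat) (X : 'I_n -> T -> R).
Hypothesis mX : forall i, measurable_fun setT (X i).
Hypothesis indX : mutually_independent P X.
Hypothesis unifX : forall i (A : set R), measurable A ->
  P (X i @^-1` A) = uniform_prob (@ltr01 R) A.

Lemma prob_below_uniform (k : nat) t : 0 <= t <= 1 ->
  P [set w | (k <= #|below (X ^~ w) t|)%N] = ((binom_tail n k).[t])%:E.
Proof.
move=> t01; rewrite -sum_subset_prob_binom_tail.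
apply: (@prob_below _ _ _ P n X t (fun=> t) (fun J => (k <= #|J|)%N) mX indX) => i.
by rewrite unifX// uniform_prob_below.
Qed.

(** With [t] the quantile of level [h], the event forces more than [i] points below [t], which has
    probability exactly [h]. *)
Lemma prob_BJ_pi_lt (i : 'I_n) h : 0 <= h <= 1 ->
  (P [set w | (BJ_pi (X ^~ w) i < h)%R] <= h%:E)%E.
Proof.
move=> h01; have [t t01 th] := binom_tail_surj (ltn_ord i) h01.
rewrite -{2}th -prob_below_uniform//; apply: le_measure; rewrite ?inE.
- exact/measurable_lt_cst/measurable_BJ_pi.
- exact: (measurable_below _ (fun J => i < #|J|)%N).
- by move=> w /=; rewrite -th; exact: BJ_pi_lt.
Qed.

(** Same argument with the quantile of level 1 - h and the complementary count event. *)
Lemma prob_BJ_pi_gt (i : 'I_n) h : 0 <= h <= 1 ->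
  (P [set w | (1 - BJ_pi (X ^~ w) i < h)%R] <= h%:E)%E.
Proof.
move=> h01.
have h01' : 0 <= 1 - h <= 1 by lra.
have [t t01 th] := binom_tail_surj (ltn_ord i) h01'.
have mB : measurable [set w | (i < #|below (X ^~ w) t|)%N].
  exact: (measurable_below _ (fun J => i < #|J|)%N).
have -> : h%:E = P (~` [set w | (i < #|below (X ^~ w) t|)%N]).
  by rewrite probability_setC// prob_below_uniform// th -EFinB; congr EFin; lra.
apply: le_measure; rewrite ?inE.
- by apply/measurable_lt_cst/measurable_funB => //; exact: measurable_BJ_pi.
- exact: measurableC.
- move=> w /= wh /(BJ_pi_le t01); rewrite th; lra.
Qed.

Lemma prob_BJ_M_lt h : 0 <= h <= 1 ->
  (P [set w | (BJ_M (X ^~ w) < h)%R] <= (h * n%:R *+ 2)%:E)%E.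
Proof.
move=> h01.
(* The default value 1 of the minimum is harmless because h <= 1. *)
have lt_bigmin (f : 'I_n -> R) : \big[minr/1]_(i < n) f i < h -> exists i, f i < h.
  move=> fh; apply: contrapT => /forallNP nfh; move: fh; apply/negP; rewrite -leNgt.
  elim/big_ind : _ => [|u v hu hv|i _]; first by case/andP: h01.
    by rewrite le_min hu.
  by rewrite leNgt; apply/negP/nfh.
pose A i := [set w | BJ_pi (X ^~ w) i < h] `|` [set w | 1 - BJ_pi (X ^~ w) i < h].
have mA i : measurable (A i).
  apply: measurableU; first exact/measurable_lt_cst/measurable_BJ_pi.
  by apply/measurable_lt_cst/measurable_funB => //; exact: measurable_BJ_pi.
apply: (@le_trans _ _ (P (\big[setU/set0]_(i < n) A i))).
  apply: le_measure; rewrite ?inE.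
  - exact/measurable_lt_cst/measurable_BJ_M.
  - exact: bigsetU_measurable.
  - move=> w /=; rewrite /BJ_M gt_min -bigcup_seq => /orP[] /lt_bigmin[i hi].
      by exists i; [rewrite /= mem_index_enum|left].
    by exists i; [rewrite /= mem_index_enum|right].
have PA i : (P (A i) <= (h *+ 2)%:E)%E.
  rewrite mulr2n EFinD (le_trans (measureU2 _ _ _)) ?leeD//.
  - exact/measurable_lt_cst/measurable_BJ_pi.
  - by apply/measurable_lt_cst/measurable_funB => //; exact: measurable_BJ_pi.
  - exact: prob_BJ_pi_lt.
  - exact: prob_BJ_pi_gt.
apply: (@le_trans _ _ (\sum_(i < n) (h *+ 2)%:E)%E); last first.
  by rewrite sumEFin sumr_const card_ord mulr_natr mulrnAC.
elim: (index_enum _) => [|i s IH]; first by rewrite !big_nil measure0.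
rewrite !big_cons; apply: le_trans (leeD (PA i) IH).
by apply: measureU2 => //; exact: bigsetU_measurable.
Qed.
End uniform_sample.
End BJ_null.

(** * The Berk-Jones statistic under an excess of small p-values *)

Section BJ_alternative.
Context {R : realType}.
Implicit Types (n k : nat) (s t h m D : R).

(** From 1 - s <= exp(-s) one gets exp(s) <= 1 / (1 - s), and the quadratic dominates this on the
    given range. The next lemma is its analogue for negative exponents. *)
Lemma expR_le_quadratic s : 0 <= s <= 2^-1 -> expR s <= 1 + s + 2 * s ^+ 2.
Proof.
move=> s01; have s1 : 0 < 1 - s by lra.
have : expR s * (1 - s) <= 1.
  rewrite -[leRHS](expRxMexpNx_1 s) ler_wpM2l ?expR_ge0//.
  exact: (expR_ge1Dx (- s)).
rewrite -ler_pdivlMr// => /le_trans; apply.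
rewrite ler_pdivrMr//.
have -> : (1 + s + 2 * s ^+ 2) * (1 - s) = 1 + s ^+ 2 * (1 - 2 * s) by ring.
by rewrite lerDl mulr_ge0 ?sqr_ge0//; lra.
Qed.

Lemma expRN_le_quadratic s : 0 <= s -> expR (- s) <= 1 - s + s ^+ 2.
Proof.
move=> s0; have s1 : 0 < 1 + s by lra.
have : expR (- s) * (1 + s) <= 1.
  rewrite -[leRHS](expRxMexpNx_1 s) mulrC ler_wpM2r ?expR_ge0//.
  exact: expR_ge1Dx.
rewrite -ler_pdivlMr// => /le_trans; apply.
rewrite ler_pdivrMr//.
have -> : (1 - s + s ^+ 2) * (1 + s) = 1 + s ^+ 3 by ring.
by rewrite lerDl exprn_ge0.
Qed.

Lemma lower_tail n (a : 'I_n -> R) m D :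
  (forall i, 0 <= a i <= 1) -> 0 < D <= m -> m + 2 * D <= \sum_i a i ->
  \sum_(J : {set 'I_n} | #|J|%:R < m + D) subset_prob a J <=
  expR (- (D ^+ 2 / (12 * m))).
Proof.
move=> a01 /andP[D0 Dm] aD; have m0 : 0 < m by lra.
(* This [s] minimises 3 m s^2 - s D, the exponent reached below; the minimum is - D^2 / (12 m). *)
pose s := D / (6 * m).
have s0 : 0 < s by rewrite divr_gt0// mulr_gt0.
have s1 : s <= 6^-1 by rewrite ler_pdivrMr ?mulr_gt0//; lra.
apply: (le_trans (subset_prob_chernoff (s := - s) (v := - s * (m + D)) a01 _)).
  by move=> J /ltW JD; rewrite !mulNr lerN2 ler_wpM2l// ltW.
rewrite ler_expR.
apply: (@le_trans _ _ ((- s + s ^+ 2) * (m + 2 * D) - - s * (m + D))).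
  rewrite lerD2r; apply: (@le_trans _ _ ((- s + s ^+ 2) * \sum_i a i)).
    apply: ler_wpM2r; first by rewrite (le_trans _ aD)//; lra.
    by have := expRN_le_quadratic (ltW s0); lra.
  (* The coefficient - s + s^2 is nonpositive, so the sum of the [a i] may be replaced by its lower
     bound. *)
  rewrite -subr_ge0 -mulrBr -mulrNN mulr_ge0//; last by lra.
  have -> : - (- s + s ^+ 2) = s * (1 - s) by ring.
  by rewrite mulr_ge0//; lra.
have -> : (- s + s ^+ 2) * (m + 2 * D) - - s * (m + D) =
  s ^+ 2 * (m + 2 * D) - s * D by ring.
apply: (@le_trans _ _ (s ^+ 2 * (3 * m) - s * D)).
  by rewrite lerD2r ler_wpM2l ?sqr_ge0//; lra.
by rewrite le_eqVlt; apply/orP; left; apply/eqP; rewrite /s; field; rewrite gt_eqF.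
Qed.

Lemma upper_tail n k t D : 0 <= t <= 1 -> 0 < D <= n%:R * t ->
  n%:R * t + D <= k%:R ->
  (binom_tail n k).[t] <= expR (- (D ^+ 2 / (8 * (n%:R * t)))).
Proof.
have [m mE] : exists m, n%:R * t = m by exists (n%:R * t).
rewrite mE => t01 /andP[D0 Dm] mk.
have m0 : 0 < m := lt_le_trans D0 Dm.
(* This [s] minimises 2 m s^2 - s D, with minimum - D^2 / (8 m). *)
pose s := D / (4 * m).
have s0 : 0 < s by rewrite divr_gt0// mulr_gt0.
have s1 : s <= 4^-1 by rewrite ler_pdivrMr ?mulr_gt0//; lra.
rewrite -sum_subset_prob_binom_tail.
apply: (le_trans (subset_prob_chernoff (s := s) (v := s * (m + D)) (fun=> t01) _)).
  move=> J kJ; rewrite ler_wpM2l ?(ltW s0)// (le_trans mk)//.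
  by rewrite ler_nat.
rewrite ler_expR sumr_const card_ord -[t *+ n]mulr_natl mE.
apply: (@le_trans _ _ ((s + 2 * s ^+ 2) * m - s * (m + D))).
  rewrite lerD2r ler_wpM2r ?(ltW m0)//.
  by have := @expR_le_quadratic s; lra.
rewrite le_eqVlt; apply/orP; left; apply/eqP; rewrite /s.
by field; rewrite gt_eqF.
Qed.

(** If N >= n t + D points lie below [t], the N-th order statistic does, and its [BJ_pi] is at most
    P(Bin(n, t) >= N) < h. Hence a large [BJ_M] forces a count below n t + D, an event bounded by
    [lower_tail]. *)
Lemma prob_BJ_M_ge d (T : measurableType d) (P : probability T R) n
    (X : 'I_n -> T -> R) (a : 'I_n -> R) t D h :
  (forall i, measurable_fun setT (X i)) -> mutually_independent P X ->
  0 <= t <= 1 ->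
  (forall i, P (X i @^-1` `]-oo, t[) = (a i)%:E) ->
  0 < D <= n%:R * t -> n%:R * t + 2 * D <= \sum_i a i ->
  expR (- (D ^+ 2 / (8 * (n%:R * t)))) < h ->
  (P [set w | (h <= BJ_M (X ^~ w))%R] <=
   (expR (- (D ^+ 2 / (12 * (n%:R * t)))))%:E)%E.
Proof.
move=> mX indX t01 Pa Dm aD hD.
have a01 i : 0 <= a i <= 1.
  rewrite -!lee_fin -Pa measure_ge0/= probability_le1//.
  by have := mX i measurableT _ (measurable_itv `]-oo, t[); rewrite setTI.
apply: (@le_trans _ _
    (P [set w | (fun J : {set 'I_n} => #|J|%:R < n%:R * t + D) (below (X ^~ w) t)])).
  apply: le_measure; rewrite ?inE.
  - have := measurable_BJ_M mX measurableT (measurable_itv `[h, +oo[).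
    rewrite setTI; congr measurable; apply/seteqP; split => w /=;
    by rewrite in_itv/= andbT.
  - exact: (measurable_below t (fun J => #|J|%:R < n%:R * t + D) mX).
  - move=> w /= hw; rewrite ltNge; apply/negP => nJ.
    have [D0 _] := andP Dm.
    have J0 : (0 < #|below (X ^~ w) t|)%N.
      by rewrite -(ltr_nat R) (lt_le_trans _ nJ)//; move: Dm; lra.
    (* The index is zero-based: N - 1 designates the largest observation below [t], which exists
       since D > 0. *)
    have Jn : (#|below (X ^~ w) t|.-1 < n)%N.
      by rewrite prednK// -[leqRHS]card_ord max_card.
    have := @BJ_pi_le R n (X ^~ w) (Ordinal Jn) t t01.
    rewrite /= prednK// => /(_ (leqnn _)) Ji.
    have : h <= BJ_pi (X ^~ w) (Ordinal Jn).
      rewrite (le_trans hw)// /BJ_M ge_min; apply/orP; left.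
      by rewrite /BJ_Mminus (bigD1 (Ordinal Jn))//= ge_min lexx.
    apply/negP; rewrite -ltNge (le_lt_trans Ji)// (le_lt_trans _ hD)//.
    exact: upper_tail.
rewrite (prob_below (fun J => #|J|%:R < n%:R * t + D) mX indX Pa) lee_fin.
exact: lower_tail.
Qed.
End BJ_alternative.

(** * Tail mass from the APLC condition *)

Section window.
Context {R : realType}.
Implicit Types (L a b c : R).
Local Notation mu := (@lebesgue_measure R).

Lemma near_ln_ge (K : R) : \forall n \near \oo, K <= ln n%:R.
Proof.
near=> n; have nK : expR K <= n%:R by near: n; exact: nbhs_infty_ger.
by rewrite -(expRK K) ler_ln// posrE ?expR_gt0// (lt_le_trans (expR_gt0 K)).
Unshelve. all: by end_near. Qed.

(** The rescaled pushforward [nu] agrees with Lebesgue measure on half-open intervals, hence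
    everywhere by uniqueness. *)
Lemma lebesgue_measure_dilate L (W : set R) : 0 < L -> measurable W ->
  mu [set u | W (u / L)] = (L%:E * mu W)%E.
Proof.
move=> L0 mW.
have mf : measurable_fun setT (fun u : R => u / L) by exact: measurable_funM.
have Li0 : 0 <= L^-1 by rewrite invr_ge0 ltW.
have [nu nuE] : exists nu : {measure set (measurableTypeR R) -> \bar R},
    forall A, nu A = ((L^-1)%:E * mu [set u | A (u / L)%R])%E.
  unshelve refine (ex_intro _ (mscale (NngNum Li0)
    (pushforward mu (fun u : measurableTypeR R => u / L : measurableTypeR R))
    : {measure set (measurableTypeR R) -> \bar R}) _); first exact: mf.
  by move=> A.
have -> : mu W = nu W.
  apply: lebesgue_measure_unique => // _ [[x y] _ <-] /=; rewrite nuE.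
  have -> : [set u | `]x, y]%classic (u / L)] = `](x * L), (y * L)]%classic.
    apply/seteqP; split => u /=; rewrite !in_itv/=.
      by rewrite ltr_pdivlMr// ler_pdivrMr.
    by rewrite ltr_pdivlMr// ler_pdivrMr.
  rewrite !lebesgue_measure_itv/= !lte_fin ltr_pM2r//.
  case: ifPn => _; last by rewrite mule0.
  by rewrite -!EFinD -EFinM; congr EFin; field; rewrite gt_eqF.
by rewrite nuE muleA -EFinM divff ?gt_eqF// mul1e.
Qed.

Lemma near_lebesgue_half a b (W : (set R)^nat) : a < b ->
  (forall n, measurable (W n)) ->
  (forall v, a <= v <= b -> \forall n \near \oo, W n v) ->
  \forall n \near \oo, (((b - a) / 2)%:E <= mu (`[a, b] `&` W n))%E.
Proof.
move=> ab mW Wv.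
(* The points at which the condition holds from rank [N] on; these sets increase to the whole
   interval. *)
pose E N := `[a, b]%classic `&` \bigcap_(n in [set n | (N <= n)%N]) W n.
have mE N : measurable (E N).
  apply: measurableI => //; apply: bigcap_measurable => //.
  by exists N => /=.
have mI n : measurable (`[a, b]%classic `&` W n) by exact: measurableI.
have EU : \bigcup_N E N = `[a, b]%classic.
  apply/seteqP; split => [v [N _ []]//|v vab].
  have := vab; rewrite /= in_itv/= => /Wv[N _ NW].
  by exists N => //; split.
have ndE : nondecreasing_seq E.
  move=> N M NM; apply/subsetPset => v [vab EN]; split => // n /= Mn.
  by apply: EN => /=; exact: leq_trans Mn.
have mEU : measurable (\bigcup_N E N) by rewrite EU.
have muE : mu (\bigcup_N E N) = (b - a)%:E.
  by rewrite EU lebesgue_measure_itv/= lte_fin ab EFinB.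
have cvE : (mu \o E) N @[N --> \oo] --> (b - a)%:E.
  by rewrite -muE; exact: nondecreasing_cvg_mu.
have half : (((b - a) / 2)%:E < (b - a)%:E)%E by rewrite lte_fin; lra.
have [N _ NE] := cvE _ (open_ereal_gt' half).
exists N => // n /= Nn; apply: (@le_trans _ _ (mu (E N))).
  exact/ltW/(NE N)/leqnn.
apply: le_measure; rewrite ?inE.
- exact: mE.
- exact: (mI n).
- by move=> v [? EN]; split => //; exact: EN.
Qed.
End window.

Section APLC_tail.
Context {R : realType}.
Local Notation mu := (@lebesgue_measure R).

(** Only the positive square root is kept in the numerator; its Gaussian exponent is (sqrt w - sqrt
    r)^2 L / sigma^2. The bound [wmax] makes the prefactor uniform over a window of [w]. *)
Lemma chi2nc_pdf_ge (r sigma A w wmax L : R) : 0 < sigma -> 0 < r -> 0 < L ->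
  0 < w <= wmax -> (Num.sqrt w - Num.sqrt r) ^+ 2 <= A ->
  normal_peak sigma / (2 * Num.sqrt (2 * wmax)) / Num.sqrt L *
    expR (- (A / sigma ^+ 2 * L)) <=
  chi2nc_pdf (Num.sqrt (2 * r * L)) sigma (2 * w * L).
Proof.
move=> s0 r0 L0 /andP[w0 wm] Aw; rewrite /chi2nc_pdf.
have sL0 : 0 < Num.sqrt L by rewrite sqrtr_gt0.
have s20 : 0 < Num.sqrt (2 * w) by rewrite sqrtr_gt0 mulr_gt0.
have s2m0 : 0 < Num.sqrt (2 * wmax) by rewrite sqrtr_gt0 mulr_gt0// (lt_le_trans w0).
have den : (2 * Num.sqrt (2 * wmax) * Num.sqrt L)^-1 <= (2 * Num.sqrt (2 * w * L))^-1.
  rewrite lef_pV2 ?posrE ?mulr_gt0// ?sqrtr_gt0 ?mulr_gt0//.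
  rewrite sqrtrM ?mulr_ge0// ?(ltW w0)// mulrA ler_wpM2r ?sqrtr_ge0//.
  by rewrite ler_wpM2l// ler_wsqrtr// ler_wpM2l.
have num : normal_peak sigma * expR (- (A / sigma ^+ 2 * L)) <=
    normal_pdf (Num.sqrt (2 * r * L)) sigma (Num.sqrt (2 * w * L)) +
    normal_pdf (Num.sqrt (2 * r * L)) sigma (- Num.sqrt (2 * w * L)).
  rewrite (le_trans _ (ler_wpDr (normal_pdf_ge0 _ _ _) (lexx _)))//.
  rewrite normal_pdfE ?gt_eqF// ler_wpM2l ?normal_peak_ge0// ler_expR.
  rewrite -!mulrA !(sqrtrM (w * L)) ?(sqrtrM (r * L)) ?(sqrtrM _ (ltW w0)) ?(sqrtrM _ (ltW r0))//.
  rewrite -mulrBr exprMn sqr_sqrtr// -mulrBl exprMn sqr_sqrtr ?(ltW L0)//.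
  rewrite mulNr lerN2.
  have -> : 2 * ((Num.sqrt w - Num.sqrt r) ^+ 2 * L) / (sigma ^+ 2 *+ 2) =
     (Num.sqrt w - Num.sqrt r) ^+ 2 * (L / sigma ^+ 2).
    by field; rewrite gt_eqF.
  by rewrite [(_ ^+ 2)^-1 * L]mulrC ler_wpM2r// divr_ge0 ?sqr_ge0// ltW.
rewrite [leLHS](_ : _ = normal_peak sigma * expR (- (A / sigma ^+ 2 * L)) *
   (2 * Num.sqrt (2 * wmax) * Num.sqrt L)^-1); last first.
  by rewrite -[_ / _ / _]mulrA -invfM mulrAC.
rewrite ler_pM// ?mulr_ge0 ?normal_peak_ge0 ?expR_ge0//.
Qed.

Lemma APLC_near (r sigma eta v : R) (g : forall n : nat, 'I_n -> R -> R) :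
  APLC r sigma g -> 0 < eta -> 0 < v ->
  \forall n \near \oo, forall i : 'I_n,
    0 < chi2nc_pdf (mu_n r n) sigma (v * ln n%:R) ->
    expR (- (eta * ln n%:R)) * chi2nc_pdf (mu_n r n) sigma (v * ln n%:R) <=
    g n i (v * ln n%:R).
Proof.
move=> ag eta0 v0; have [gpos /cvgr0_norm_lt/(_ _ eta0) gcv] := ag v v0.
near=> n => i chi0.
have L0 : 0 < ln n%:R :> R.
  by apply: (@lt_le_trans _ _ 1) => //; near: n; exact: near_ln_ge.
(* Positivity of the ratio is required to invert [ln], which is a total function. *)
have gi0 : 0 < g n i (v * ln n%:R) by move: i {chi0}; near: n; exact: gpos.
have : `|(ln n%:R)^-1 * \big[maxr/0]_(i < n)
          `| ln (g n i (v * ln n%:R) / chi2nc_pdf (mu_n r n) sigma (v * ln n%:R))| | < eta.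
  by near: n.
rewrite mulrC normrM (gtr0_norm (x := _^-1)) ?invr_gt0// ltr_pdivrMr// => /ltW H.
have {}H := le_trans (ler_norm _) H.
have /= := le_trans (le_bigmax 0
  (fun i => `| ln (g n i (v * ln n%:R) / chi2nc_pdf (mu_n r n) sigma (v * ln n%:R))|) i) H.
rewrite ler_norml => /andP[ge _].
by rewrite -ler_pdivlMr// -[leRHS]lnK ?ler_expR// posrE (divr_gt0 gi0 chi0).
Unshelve. all: by end_near. Qed.

(** The density of Q_i is at least [c n], for all i at once, on at least half of the window from 2
    w1 ln n to 2 w2 ln n, which lies in the tail because q < w1. *)
Lemma near_tail_mass (r sigma A q w1 w2 eta : R)
    (g : forall n : nat, 'I_n -> R -> R) :
  0 < sigma -> 0 < r -> 0 < eta -> 0 < q -> q < w1 -> w1 < w2 ->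
  (forall w, w1 <= w <= w2 -> (Num.sqrt w - Num.sqrt r) ^+ 2 <= A) ->
  (forall n (i : 'I_n), measurable_fun (`]0%R, +oo[%classic : set R) (g n i)) ->
  (forall n (i : 'I_n) u, 0 < u -> 0 <= g n i u) ->
  APLC r sigma g ->
  \forall n \near \oo, forall i : 'I_n,
    ((expR (- ((A / sigma ^+ 2 + eta) * ln n%:R)))%:E <=
     law_of_density (g n i) `](2 * q * ln n%:R)%R, +oo[)%E.
Proof.
move=> s0 r0 eta0 q0 qw1 w12 wA mg g0 ag.
pose K := normal_peak sigma / (2 * Num.sqrt (2 * w2)).
have K0 : 0 < K.
  by rewrite divr_gt0 ?normal_peak_gt0 ?gt_eqF// mulr_gt0// sqrtr_gt0; lra.
pose L n : R := ln n%:R.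
pose c n := expR (- (eta * L n)) * (K / Num.sqrt (L n) * expR (- (A / sigma ^+ 2 * L n))).
(* The positivity clause keeps [W n] where [g n i] is known to be measurable. *)
pose W n := [set v : R | 0 < v * L n /\ forall i : 'I_n, c n <= g n i (v * L n)].
have mW n : measurable (W n).
  pose D := [set v : R | 0 < v * L n].
  have mf : measurable_fun setT (fun v : R => v * L n) by exact: measurable_funM.
  have mD : measurable D.
    rewrite [D](_ : _ = setT `&` (fun v : R => v * L n) @^-1` `]0, +oo[%classic).
      exact: mf.
    by apply/seteqP; split => v /=; rewrite in_itv/= andbT; [|case].
  have -> : W n = D `&` \bigcap_(i in [set: 'I_n])
      (D `&` (fun v => g n i (v * L n)) @^-1` `[c n, +oo[%classic).
    apply/seteqP; split => [v [Dv gv]|v [Dv gv]]; split => // i.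
      by move=> _; split => //=; rewrite in_itv/= gv.
    by have [_ /=] := gv i I; rewrite in_itv/= andbT.
  apply: measurableI => //; apply: fin_bigcap_measurable => // i _.
  have mgD : measurable_fun D (g n i \o (fun v : R => v * L n)).
    refine (measurable_comp _ _ (mg n i) _) => //.
    - by move=> _ [v Dv <-]; rewrite /= in_itv/= andbT.
    - exact: measurable_funS mf.
  exact: mgD.
have Wv v : 2 * w1 <= v <= 2 * w2 -> \forall n \near \oo, W n v.
  move=> vw; have v0 : 0 < v by lra.
  near=> n.
  have L0 : 0 < L n.
    by apply: (@lt_le_trans _ _ 1) => //; near: n; exact: near_ln_ge.
  split => [|i]; first by rewrite mulr_gt0.
  have chi : K / Num.sqrt (L n) * expR (- (A / sigma ^+ 2 * L n)) <=
      chi2nc_pdf (mu_n r n) sigma (v * L n).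
    have -> : v = 2 * (v / 2) by field.
    apply: chi2nc_pdf_ge => //; first by apply/andP; split; lra.
    by apply: wA; apply/andP; split; lra.
  apply: (@le_trans _ _ (expR (- (eta * L n)) * chi2nc_pdf (mu_n r n) sigma (v * L n))).
    by apply: ler_wpM2l; [exact: expR_ge0|exact: chi].
  have chi0 : 0 < chi2nc_pdf (mu_n r n) sigma (v * L n).
    by apply: lt_le_trans chi; rewrite mulr_gt0 ?expR_gt0// divr_gt0 ?sqrtr_gt0.
  by move: i chi0; near: n; exact: APLC_near.
have w12' : 2 * w1 < 2 * w2 by lra.
have := near_lebesgue_half w12' mW Wv => muW.
near=> n => i.
have L1 : 1 <= L n by near: n; exact: near_ln_ge.
have L0 : 0 < L n by exact: lt_le_trans L1.
have c0 : 0 <= c n.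
  by rewrite !mulr_ge0 ?expR_ge0 ?invr_ge0 ?sqrtr_ge0// ltW.
have muWn : (((2 * w2 - 2 * w1) / 2)%:E <=
    mu (`[(2 * w1)%R, (2 * w2)%R] `&` W n))%E by near: n; exact: muW.
(* The window length grows like L and the density prefactor decays like 1 / sqrt L; the remaining
   sqrt L absorbs the constant. *)
have LK : ((K * (w2 - w1))^-1) ^+ 2 <= L n by near: n; exact: near_ln_ge.
pose V := `[2 * w1, 2 * w2]%classic `&` W n.
have mV : measurable V by exact: measurableI.
pose U := [set u | V (u / L n)].
have mU : measurable U.
  have mf : measurable_fun setT (fun u : R => u / L n) by exact: measurable_funM.
  by have := mf measurableT _ mV; rewrite setTI.
have U0 u : U u -> 2 * q * L n < u /\ c n <= g n i u.
  move=> [/=]; rewrite in_itv/= => /andP[uw _] [_ /(_ i)].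
  rewrite divfK ?gt_eqF//; split => //; move: uw; rewrite ler_pdivlMr//.
  by apply: lt_le_trans; rewrite ltr_pM2r// ltr_pM2l.
have q0L : 0 < 2 * q * L n by rewrite !mulr_gt0.
apply: (@le_trans _ _ (\int[mu]_(u in U) (g n i u)%:E)%E); last first.
  apply: ge0_subset_integral => //.
  - by apply: measurableI.
  - apply/measurable_EFinP; refine (measurable_funS _ _ (mg n i)) => //.
  - by move=> u [_ /=]; rewrite in_itv/= andbT lee_fin => /g0.
  - move=> u /U0[qu _]; split; rewrite /= in_itv/= andbT//.
    exact: lt_trans qu.
apply: (@le_trans _ _ (\int[mu]_(u in U) (c n)%:E)%E); last first.
  apply: ge0_le_integral => //.
  - apply/measurable_EFinP; refine (measurable_funS _ _ (mg n i)) => //.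
    by move=> u /U0[qu _]; rewrite /= in_itv/= andbT (lt_trans q0L qu).
  - by move=> u /U0[_ cu]; rewrite lee_fin.
rewrite integral_cst//.
have muU : mu U = ((L n)%:E * mu V)%E by exact: lebesgue_measure_dilate.
have -> : ((c n)%:E * mu U = (c n * L n)%:E * mu V)%E.
  by rewrite muU muleA EFinM.
apply: (@le_trans _ _ ((c n * L n)%:E * ((2 * w2 - 2 * w1) / 2)%:E)%E); last first.
  by apply: lee_wpmul2l => //; rewrite lee_fin mulr_ge0// ltW.
rewrite -EFinM lee_fin.
have sL0 : 0 < Num.sqrt (L n) by rewrite sqrtr_gt0.
have KL : 1 <= K * (w2 - w1) * Num.sqrt (L n).
  have KW0 : 0 < K * (w2 - w1) by rewrite mulr_gt0// subr_gt0.
  rewrite -ler_pdivrMl// mulr1 -[leLHS]ger0_norm ?invr_ge0 ?(ltW KW0)//.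
  by rewrite -sqrtr_sqr ler_wsqrtr.
have -> : expR (- ((A / sigma ^+ 2 + eta) * L n)) =
    expR (- (eta * L n)) * expR (- (A / sigma ^+ 2 * L n)).
  by rewrite -expRD; congr expR; ring.
rewrite /c -[X in _ * (K / _ * _) * X](sqr_sqrtr (ltW L0)).
have -> : expR (- (eta * L n)) *
    (K / Num.sqrt (L n) * expR (- (A / sigma ^+ 2 * L n))) *
    Num.sqrt (L n) ^+ 2 * ((2 * w2 - 2 * w1) / 2) =
  expR (- (eta * L n)) * expR (- (A / sigma ^+ 2 * L n)) *
    (K * (w2 - w1) * Num.sqrt (L n)).
  by field; rewrite gt_eqF.
by rewrite ler_peMr ?mulr_ge0 ?expR_ge0.
Unshelve. all: by end_near. Qed.
End APLC_tail.

(** * The detection boundary *)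

Section detection_boundary.
Context {R : realType}.
Implicit Types (beta r sigma : R).

(* [n ^ - x ^+ 2] is the level at which p-values are counted and
   [2 y ^+ 2 ln n] the place where the tail mass of Q_i is collected.  The
   maximum of [(1 + x ^+ 2) / 2 - (x - sqrt r) ^+ 2 / sigma ^+ 2] over
   [0 < x <= 1] is attained at [x = 2 sqrt r / (2 - sigma ^+ 2)] if this is at
   most 1 and [sigma ^+ 2 < 2], and at [x = 1] otherwise; [y] is the maximum
   of [x] and [sqrt r]. *)
Lemma detection_exponent beta r sigma :
  2^-1 < beta < 1 -> 0 < r -> 0 < sigma -> rho beta sigma < r ->
  exists x y : R, [/\ 0 < x, x <= 1, x <= y &
    beta + (y - Num.sqrt r) ^+ 2 / sigma ^+ 2 < (1 + x ^+ 2) / 2].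
Proof.
move=> /andP[b2 b1] r0 s0 hrho.
set s := Num.sqrt r; have sr : s ^+ 2 = r by rewrite sqr_sqrtr// ltW.
have sgt0 : 0 < s by rewrite sqrtr_gt0.
set tau := Num.sqrt (1 - beta).
have tau2 : tau ^+ 2 = 1 - beta by rewrite sqr_sqrtr//; lra.
have tau0 : 0 < tau by rewrite sqrtr_gt0; lra.
have sg2 : 0 < sigma ^+ 2 by rewrite exprn_gt0.
(* Above the curve (1 - sigma tau)^2, counting at x = 1 suffices. Below it, [sq_le] and s > 0 leave
   only the linear branch of [rho]. *)
have [st|st] := ltP (1 - sigma * tau) s.
  have [s1|s1] := leP 1 s.
    by exists 1, s; split => //; rewrite subrr expr0n mul0r; lra.
  exists 1, 1; split => //.
  suff : (1 - s) ^+ 2 / sigma ^+ 2 < 1 - beta by rewrite expr1n; lra.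
  rewrite ltr_pdivrMr// -tau2 mulrC -exprMn ltr_pXn2r// ?nnegrE;
    by rewrite ?mulr_ge0 ?(ltW s0) ?(ltW tau0)//; lra.
have ts : tau * sigma <= 1 by rewrite mulrC; lra.
have sq_le : (1 - sigma * tau) ^+ 2 < r -> False.
  by apply/negP; rewrite -leNgt -sr ler_pXn2r// ?nnegrE; lra.
move: hrho; rewrite /rho -/tau; case: ifPn => [|/negP/negP]; rewrite -?leNgt => sg; last first.
  case: ifPn => [bs _|_ /sq_le//].
  have : 1 < (sigma * tau) ^+ 2.
    by rewrite exprMn tau2 -ltr_pdivrMl// mulr1; lra.
  by rewrite -[X in X < _](expr1n _ 2) ltr_pXn2r ?nnegrE ?mulr_ge0 ?(ltW s0) ?(ltW tau0)//; lra.
case: ifPn => [bs hrho|_ /sq_le//].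
set c := 2 - sigma ^+ 2 in hrho.
have c0 : 0 < c by rewrite /c; lra.
(* Here beta < 1 - sigma^2 / 4 means tau > sigma / 2, so s <= 1 - sigma tau <= c / 2; this gives x
   <= 1. *)
have sc : s <= c / 2.
  apply: (le_trans st).
  suff : sigma / 2 < tau.
    move=> /ltW/(ler_wpM2l (ltW s0)); rewrite /c mulrA -expr2; lra.
  rewrite -(ltr_pXn2r (n := 2))// ?nnegrE ?divr_ge0 ?(ltW s0) ?(ltW tau0)//.
  by rewrite tau2 expr_div_n; have -> : (2 : R) ^+ 2 = 4 by [ring]; lra.
exists (2 * s / c), (2 * s / c); split => //.
- by rewrite divr_gt0// mulr_gt0.
- by rewrite ler_pdivrMr// mul1r; lra.
have -> : (2 * s / c - s) ^+ 2 / sigma ^+ 2 = r * sigma ^+ 2 / c ^+ 2.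
  have -> : 2 * s / c - s = s * sigma ^+ 2 / c by rewrite /c; field; rewrite -/c gt_eqF.
  by rewrite -sr; field; rewrite !gt_eqF.
have -> : (2 * s / c) ^+ 2 = 4 * r / c ^+ 2 by rewrite -sr; field; rewrite gt_eqF.
rewrite -subr_gt0.
have -> : (1 + 4 * r / c ^+ 2) / 2 - (beta + r * sigma ^+ 2 / c ^+ 2) =
   (r - c * (beta - 2^-1)) / c.
  by rewrite /c; field; rewrite -/c gt_eqF.
by rewrite divr_gt0// subr_gt0.
Qed.

(** The strict inequality of [detection_exponent] leaves a slack [G]. Half of it pays for lowering q
    below x^2 and for widening the point y^2 to a window; the other half is [gam]. *)
Lemma detection_window beta r sigma :
  2^-1 < beta < 1 -> 0 < r -> 0 < sigma -> rho beta sigma < r ->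
  exists q w1 w2 A gam : R, [/\ 0 < q < 1, q < w1, w1 < w2,
    forall w, w1 <= w <= w2 -> (Num.sqrt w - Num.sqrt r) ^+ 2 <= A &
    0 < gam /\ (1 - q) / 2 + gam <= 1 - beta - A / sigma ^+ 2].
Proof.
move=> hb r0 s0 /(detection_exponent hb r0 s0)[x [y [x0 x1 xy G0]]].
set s := Num.sqrt r in G0 *; pose d := `|y - s|.
have sg2 : 0 < (sigma ^+ 2)^-1 by rewrite invr_gt0 exprn_gt0.
rewrite -(real_normK (num_real (y - s))) -/d in G0.
have d0 : 0 <= d by exact: normr_ge0.
pose G := (1 + x ^+ 2) / 2 - (beta + d ^+ 2 / sigma ^+ 2).
have {}G0 : 0 < G by rewrite subr_gt0.
(* Cost per unit of [del]: 1/2 from q, since x^2 <= 1, and (2 d + 1) / sigma^2 from (d + del)^2,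
   since del^2 <= del. *)
pose c := 2^-1 + (2 * d + 1) / sigma ^+ 2.
have c0 : 0 < c.
  by rewrite addr_gt0 ?invr_gt0// mulr_gt0// ltr_wpDl ?mulr_ge0.
pose del := minr 2^-1 (G / 2 / c).
have del0 : 0 < del.
  have G2 : 0 < G / 2 by rewrite divr_gt0.
  by rewrite lt_min invr_gt0 ltr0n (divr_gt0 G2 c0).
have del1 : del <= 2^-1 by rewrite ge_min lexx.
have delG : del * c <= G / 2 by rewrite -ler_pdivlMr// ge_min lexx orbT.
have xx0 : 0 < x ^+ 2 by rewrite exprn_gt0.
have xx1 : x ^+ 2 <= 1 by rewrite exprn_ile1// ltW.
exists (x ^+ 2 * (1 - del)), (y ^+ 2), ((y + del) ^+ 2), ((d + del) ^+ 2), (G / 2).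
have xd : x ^+ 2 * del <= del by rewrite ler_piMl// ltW.
have xd0 : 0 < x ^+ 2 * del by rewrite mulr_gt0.
have y0 : 0 < y by lra.
split.
- rewrite mulr_gt0//=; last by lra.
  by rewrite mulrBr mulr1; lra.
- have : x ^+ 2 <= y ^+ 2 by rewrite ler_pXn2r// nnegrE ltW.
  by rewrite mulrBr mulr1; lra.
- by rewrite ltr_pXn2r ?nnegrE ?ltrDl//; lra.
- move=> w /andP[w1 w2].
  have w1' : y <= Num.sqrt w by rewrite -(ger0_norm (ltW y0)) -sqrtr_sqr ler_wsqrtr.
  have w2' : Num.sqrt w <= y + del.
    have yd : 0 <= y + del by lra.
    by rewrite -(ger0_norm yd) -sqrtr_sqr ler_wsqrtr.
  rewrite -(real_normK (num_real (_ - s))) ler_pXn2r ?nnegrE ?addr_ge0 ?(ltW del0)//.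
  rewrite (_ : Num.sqrt w - s = (y - s) + (Num.sqrt w - y)); last by ring.
  by rewrite (le_trans (ler_normD _ _))// lerD2l ger0_norm; lra.
- split; first by rewrite divr_gt0.
  have h : (d + del) ^+ 2 / sigma ^+ 2 <= d ^+ 2 / sigma ^+ 2 + del * ((2 * d + 1) / sigma ^+ 2).
    rewrite mulrA -mulrDl ler_wpM2r ?(ltW sg2)//.
    have : del ^+ 2 <= del by rewrite expr2 ler_piMl ?ltW//; lra.
    have -> : (d + del) ^+ 2 = d ^+ 2 + 2 * d * del + del ^+ 2 by ring.
    lra.
  move: delG; rewrite /c mulrDr /G mulrBr mulr1; lra.
Qed.

(** This law is exponential of rate 1/2, so [F] is an antiderivative of the density that vanishes at
    infinity. *)
Lemma law_chi2_2_tail (a : R) : 0 < a ->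
  law_of_density chi2_2_pdf `]a, +oo[ = (expR (- a / 2))%:E.
Proof.
move=> a0; rewrite /law_of_density.
have -> : `]a, +oo[ `&` `]0, +oo[ = `]a, +oo[%classic :> set R.
  by apply/seteqP; split => [x []//|x /=]; rewrite !in_itv/= !andbT => ax; split => //; lra.
pose F (u : R) := - expR (- 2^-1 * u).
have cf : continuous (@chi2_2_pdf R).
  move=> x; apply: cvgM; last exact: cvg_cst.
  apply: continuous_comp; last exact: continuous_expR.
  by apply: cvgM; [apply: cvgN; exact: cvg_id|exact: cvg_cst].
rewrite integral_itv_obnd_cbnd; last first.
  apply/measurable_EFinP; apply: measurable_funTS.
  exact: continuous_measurable_fun.
have FE : F = fun u => - expR (- u / 2).
  by apply/funext => u; rewrite /F mulNr mulrC mulNr.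
have cF : continuous F.
  rewrite FE => x; apply: cvgN; apply: continuous_comp; last exact: continuous_expR.
  by apply: cvgM; [apply: cvgN; exact: cvg_id|exact: cvg_cst].
rewrite (@ge0_continuous_FTC2y _ _ F a 0).
- by rewrite -EFinB sub0r FE opprK.
- by move=> x _; rewrite divr_ge0 ?expR_ge0.
- exact: continuous_subspaceT.
- rewrite -oppr0; apply: cvgN.
  rewrite (_ : (fun x => expR (- 2^-1 * x)) =
               (fun z => expR (- z)) \o (fun z => 2^-1 * z)); last first.
    by apply: eq_fun => x; rewrite mulNr.
  apply: (@cvg_comp _ _ _ _ _ _ (pinfty_nbhs R)); last exact: cvgr_expR.
  exact: gt0_cvgMry.
- by move=> x _; exact: ex_derive.
- exact/cvg_at_right_filter/cF.
- move=> x; rewrite in_itv/= andbT => ax; have x0 : 0 < x := lt_trans a0 ax.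
  rewrite derive1_exponential_pdf ?in_itv/= ?andbT//.
  by rewrite exponential_pdfE ?(ltW x0)// /chi2_2_pdf mulrC !mulNr (mulrC x).
Qed.
End detection_boundary.

(** * Asymptotics *)

Section main.
Context {R : realType}.

(** The quadratic term of the exponential series already outgrows a linear function of ln n. *)
Lemma near_expR_gt (k c : R) : 0 < k ->
  \forall n \near \oo, c * ln n%:R < expR (k * ln n%:R).
Proof.
move=> k0; near=> n.
have L0 : 0 <= ln n%:R :> R by near: n; exact: near_ln_ge.
have Lc : c / (k ^+ 2 / 2) <= ln n%:R by near: n; exact: near_ln_ge.
have k20 : 0 < k ^+ 2 / 2 by rewrite divr_gt0// exprn_gt0.
have kL : 0 <= k * ln n%:R by rewrite mulr_ge0// ltW.
apply: lt_le_trans (expR_ge1Dxn 1 kL).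
have -> : (k * ln n%:R) ^+ 2 / 2`!%:R = k ^+ 2 / 2 * ln n%:R * ln n%:R.
  by rewrite exprMn [2`!%N]/=; ring.
rewrite (@le_lt_trans _ _ (k ^+ 2 / 2 * ln n%:R * ln n%:R))//; last by lra.
by rewrite ler_wpM2r// -ler_pdivrMl// mulrC.
Unshelve. all: by end_near. Qed.

Lemma near_prob_BJ_M_ge (beta r sigma : R)
  (hbeta : 2^-1 < beta < 1) (hr : 0 < r) (hsigma : 0 < sigma)
  (hrho : rho beta sigma < r)
  (g : forall n : nat, 'I_n -> R -> R)
  (g_meas : forall n (i : 'I_n), measurable_fun (`]0%R, +oo[%classic : set R) (g n i))
  (g_ge0 : forall n (i : 'I_n) u, 0 < u -> 0 <= g n i u)
  (g_aplc : APLC r sigma g)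
  (d : measure_display) (T : measurableType d)
  (P : nat -> probability T R) (p : forall n : nat, 'I_n -> T -> R) :
  (forall n (i : 'I_n), measurable_fun setT (p n i)) ->
  (forall n (i : 'I_n) w, 0 < p n i w < 1) ->
  (forall n, mutually_independent (P n) (p n)) ->
  (forall n (i : 'I_n) (A : set R), measurable A ->
     P n ((fun w => - 2 * ln (p n i w)) @^-1` A) =
     ((1 - eps_n beta n)%:E * law_of_density chi2_2_pdf A
      + (eps_n beta n)%:E * law_of_density (g n i) A)%E) ->
  \forall n \near \oo,
    (P n [set w | (expR (- (2 * ln n%:R)) <= BJ_M (fun i => p n i w))%R] <=
     (expR (- ln n%:R))%:E)%E.
Proof.
move=> mp p01 indp lawp.
have [q [w1 [w2 [A [gam [/andP[q0 q1] qw1 w12 wA [gam0 hgam]]]]]]] :=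
  detection_window hbeta hr hsigma hrho.
have /andP[b2 b1] := hbeta.
(* The first bound keeps 4 D below the contamination; the second gives D <= m, as the Chernoff
   bounds require. *)
pose k := minr (gam / 2) ((1 - q) / 2).
have k0 : 0 < k by rewrite lt_min !divr_gt0// subr_gt0.
have kgam : k <= gam / 2 by rewrite ge_min lexx.
have kq : k <= (1 - q) / 2 by rewrite ge_min lexx orbT.
have eta0 : 0 < gam / 2 by rewrite divr_gt0.
near=> n.
have L1 : 1 <= ln n%:R :> R by near: n; exact: near_ln_ge.
have kL1 : k^-1 <= ln n%:R by near: n; exact: near_ln_ge.
have Qn (i : 'I_n) : ((expR (- ((A / sigma ^+ 2 + gam / 2) * ln n%:R)))%:E <=
     law_of_density (g n i) `](2 * q * ln n%:R)%R, +oo[)%E.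
  by move: i; near: n;
  exact: (near_tail_mass hsigma hr eta0 q0 qw1 w12 wA g_meas g_ge0 g_aplc).
(* As D^2 / m = n^(2k) / 16, the constant 256 makes D^2 / (8 m) exceed 2 ln n and D^2 / (12 m)
   exceed ln n. *)
have big : 256 * ln n%:R < expR (2 * k * ln n%:R).
  by near: n; apply: near_expR_gt; rewrite mulr_gt0.
have n0 : 0 < n%:R :> R by near: n; exact: nbhs_infty_gtr.
pose L : R := ln n%:R; rewrite -/L in L1 kL1 Qn big *.
have L0 : 0 < L by exact: lt_le_trans L1.
have {}kL1 : 1 <= k * L by rewrite -ler_pdivrMl// mulr1.
have nL : n%:R = expR L by rewrite lnK// posrE.
pose t := expR (- (q * L)).
have t01 : 0 <= t <= 1.
  by rewrite expR_ge0/= -expR0 ler_expR oppr_le0 mulr_ge0 ?(ltW q0) ?(ltW L0).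
pose m := n%:R * t.
have mE : m = expR ((1 - q) * L) by rewrite /m nL -expRD; congr expR; ring.
pose D := expR (((1 - q) / 2 + k) * L) / 4.
have D0 : 0 < D by rewrite divr_gt0 ?expR_gt0.
have Dm : D <= m.
  rewrite /D mE (@le_trans _ _ (expR (((1 - q) / 2 + k) * L)))//.
    by rewrite ler_pdivrMr// ler_peMr ?expR_ge0//; lra.
  by rewrite ler_expR ler_wpM2r ?(ltW L0)//; lra.
have D2m : D ^+ 2 / m = expR (2 * k * L) / 16.
  rewrite /D mE expr_div_n -expRM_natl -mulrAC -expRN -expRD.
  have -> : (4 : R) ^+ 2 = 16 by ring.
  by congr (expR _ / _); field.
have m0 : 0 < m := lt_le_trans D0 Dm.
have mfin (i : 'I_n) (x : R) : measurable (p n i @^-1` `]-oo, x[).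
  by have := mp n i measurableT _ (measurable_itv `]-oo, x[); rewrite setTI.
pose a (i : 'I_n) : R := fine (P n (p n i @^-1` `]-oo, t[)).
have Pa i : P n (p n i @^-1` `]-oo, t[) = (a i)%:E.
  by rewrite fineK// fin_num_measure.
have eps0 : 0 <= eps_n beta n by exact: powR_ge0.
have epsE : eps_n beta n = expR (- (beta * L)).
  by rewrite /eps_n /powR gt_eqF// mulNr.
have Pge i : (1 - eps_n beta n) * t +
    eps_n beta n * expR (- ((A / sigma ^+ 2 + gam / 2) * L)) <= a i.
  have preE : p n i @^-1` `]-oo, t[ =
      (fun w => - 2 * ln (p n i w)) @^-1` `](2 * q * L)%R, +oo[.
    apply/funext => w /=; rewrite !in_itv/= andbT; congr is_true.
    have /andP[p0 _] := p01 n i w.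
    by rewrite -[in LHS](lnK p0) ltr_expR; apply/idP/idP; lra.
  rewrite -lee_fin -Pa preE lawp// law_chi2_2_tail ?mulr_gt0//.
  rewrite EFinD -!EFinM leeD//.
    by rewrite lee_fin le_eqVlt; apply/orP; left; apply/eqP; congr (_ * expR _); field.
  by rewrite EFinM; apply: lee_wpmul2l => //; rewrite lee_fin.
(* Contamination adds at least 4 D ([h1]), while the null mass it displaces, n^(1 - q - beta), is at
   most 2 D ([h2]) because beta > 1/2. *)
have suma : m + 2 * D <= \sum_i a i.
  apply: (@le_trans _ _ (\sum_(i < n) ((1 - eps_n beta n) * t +
      eps_n beta n * expR (- ((A / sigma ^+ 2 + gam / 2) * L))))); last exact: ler_sum.
  rewrite sumr_const card_ord -[X in _ <= X]mulr_natl.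
  have -> : n%:R * ((1 - eps_n beta n) * t +
      eps_n beta n * expR (- ((A / sigma ^+ 2 + gam / 2) * L))) =
    m - expR ((1 - q - beta) * L) +
    expR ((1 - beta - A / sigma ^+ 2 - gam / 2) * L).
    rewrite mulrDr mulrBl mul1r mulrBr -/m; congr (_ - _ + _).
      by rewrite epsE nL -!expRD; congr expR; ring.
    by rewrite epsE nL -!expRD; congr expR; ring.
  have h1 : 4 * D <= expR ((1 - beta - A / sigma ^+ 2 - gam / 2) * L).
    rewrite /D mulrCA divff// mulr1 ler_expR ler_wpM2r ?(ltW L0)//; lra.
  have h2 : expR ((1 - q - beta) * L) <= 2 * D.
    have : expR ((1 - q - beta) * L + k * L) <= 4 * D.
      by rewrite /D mulrCA divff// mulr1 ler_expR -mulrDl ler_wpM2r ?(ltW L0)//; lra.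
    rewrite expRD => h3.
    have h4 : 2 <= expR (k * L) by have := expR_ge1Dx (k * L); lra.
    have := ler_wpM2l (expR_ge0 ((1 - q - beta) * L)) h4; lra.
  lra.
apply: (@le_trans _ _ (expR (- (D ^+ 2 / (12 * m))))%:E).
  apply: (prob_BJ_M_ge (mp n) (indp n) t01 Pa _ suma); first by rewrite D0.
  rewrite ltr_expR ltrN2 -/m -/L.
  have -> : D ^+ 2 / (8 * m) = D ^+ 2 / m / 8 by field; rewrite gt_eqF.
  by rewrite D2m; lra.
rewrite lee_fin ler_expR lerN2.
have -> : D ^+ 2 / (12 * m) = D ^+ 2 / m / 12 by field; rewrite gt_eqF.
by rewrite D2m -/L; lra.
Unshelve. all: by end_near. Qed.
End main.

Unset Implicit Arguments.

Theorem theorem3 (R : realType) (beta r sigma : R)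
  (hbeta : 2^-1 < beta < 1) (hr : 0 < r) (hsigma : 0 < sigma)
  (hrho : rho beta sigma < r)
  (g : forall n : nat, 'I_n -> R -> R)
  (g_meas : forall n (i : 'I_n), measurable_fun (`]0%R, +oo[%classic : set R) (g n i))
  (g_ge0 : forall n (i : 'I_n) u, 0 < u -> 0 <= g n i u)
  (g_int1 : forall n (i : 'I_n), law_of_density (g n i) setT = 1%E)
  (g_aplc : APLC r sigma g) :
  exists h : nat -> R,
  forall (d : measure_display) (T : measurableType d)
    (P0 P1 : nat -> probability T R) (p0 p1 : forall n : nat, 'I_n -> T -> R),
    (* H0: p_1..p_n i.i.d. Unif(0,1) *)
    (forall n (i : 'I_n), measurable_fun setT (p0 n i)) ->
    (forall n (i : 'I_n) w, 0 < p0 n i w < 1) ->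
    (forall n, mutually_independent (P0 n) (p0 n)) ->
    (forall n (i : 'I_n) (A : set R), measurable A ->
       P0 n (p0 n i @^-1` A) = uniform_prob (@ltr01 R) A) ->
    (* H1^(n): independent, -2 log p_i ~ (1-eps_n) chi2_2 + eps_n Q_i^(n) *)
    (forall n (i : 'I_n), measurable_fun setT (p1 n i)) ->
    (forall n (i : 'I_n) w, 0 < p1 n i w < 1) ->
    (forall n, mutually_independent (P1 n) (p1 n)) ->
    (forall n (i : 'I_n) (A : set R), measurable A ->
       P1 n ((fun w => - 2 * ln (p1 n i w)) @^-1` A) =
       ((1 - eps_n beta n)%:E * law_of_density chi2_2_pdf A
        + (eps_n beta n)%:E * law_of_density (g n i) A)%E) ->
    (fun n : nat =>
       P0 n [set w | (BJ_M (fun i => p0 n i w) < h n)%R] +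
       P1 n [set w | (h n <= BJ_M (fun i => p1 n i w))%R])%E @ \oo --> 0%E.
Proof.
exists (fun n => expR (- (2 * ln n%:R))) => d T P0 P1 p0 p1 mp0 p001 ind0 unif0
  mp1 p101 ind1 law1.
have H1 := near_prob_BJ_M_ge hbeta hr hsigma hrho g_meas g_ge0 g_aplc mp1 p101 ind1 law1.
(* The null error is at most 2 n n^-2 = 2 / n and the other one is eventually at most 1 / n. *)
apply: (@squeeze_cvge _ _ _ _ (fun=> 0%E) _ (fun n => (3 * n%:R^-1)%:E)).
- near=> n.
  rewrite adde_ge0 ?measure_ge0//=.
  have n0 : 0 < n%:R :> R by near: n; exact: nbhs_infty_gtr.
  have L0 : 0 <= ln n%:R :> R by near: n; exact: near_ln_ge.
  have nE : (n%:R)^-1 = expR (- ln n%:R) :> R by rewrite expRN lnK// posrE.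
  have -> : (3 * n%:R^-1 : R)%:E = ((n%:R^-1 *+ 2)%:E + (n%:R^-1)%:E)%E.
    by rewrite -EFinD; congr EFin; ring.
  apply: leeD; last by rewrite nE; near: n; exact: H1.
  have h01 : 0 <= expR (- (2 * ln n%:R) : R) <= 1.
    by rewrite expR_ge0/= -[leRHS]expR0 ler_expR oppr_le0 mulr_ge0.
  apply: (le_trans (prob_BJ_M_lt (mp0 n) (ind0 n) (unif0 n) h01)).
  rewrite lee_fin lerMn2r/= mulrC le_eqVlt; apply/orP; left; apply/eqP.
  by rewrite -[X in X * _]lnK ?posrE// -expRD nE; congr expR; ring.
- exact: cvg_cst.
- apply: cvg_EFin; first by near=> n.
  apply/cvgrPdist_lt => e e0; near=> n => /=.
  have n0 : 0 < n%:R :> R by near: n; exact: nbhs_infty_gtr.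
  rewrite sub0r normrN ger0_norm ?divr_ge0 ?(ltW n0)// ltr_pdivrMr//.
  by rewrite -ltr_pdivrMl// mulrC; near: n; exact: nbhs_infty_gtr.
Unshelve. all: by end_near. Qed.
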